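(* Let $p,q$ be coprime positive integers and let $r\ge 1$ be an integer. Let $\overline{\mathcal{M}}_{p,q}(r)$ be the affine scheme over $\mathbb{C}$ in the affine space with coordinates $u_1,\ldots,u_{rp},v_1,\ldots,v_{rq}$ defined by the vanishing of all coefficients in the $z$-expansion of $$(1+u_1z+u_2z^2+\cdots+u_{rp}z^{rp})^{q}-(1+v_1z+v_2z^2+\cdots+v_{rq}z^{rq})^{p}.$$ Let $$W(u_1,\ldots,u_{pr})=\mathrm{Coef}_{(p+q)r+1}\left[(1+u_1z+\cdots+u_{pr}z^{pr})^{\frac{q+p}{p}}\right]\in\mathbb{C}[u_1,\ldots,u_{pr}],$$ and let $$W_{super}=\sum_{i=1}^{pr}\frac{\partial W}{\partial u_i}\,\xi_i\in\mathbb{C}[u_1,\ldots,u_{pr},\xi_1,\ldots,\xi_{pr}],$$ where the $u_i$ are even (commuting) variables and the $\xi_i$ are odd (anticommuting) variables. Then the algebra of differential forms on $\overline{\mathcal{M}}_{p,q}(r)$ is isomorphic to the Jacobi ring of $W_{super}$: $$\Omega^{\bullet}\left(\overline{\mathcal{M}}_{p,q}(r)\right)\cong \mathbb{C}[u_1,\ldots,u_{pr},\xi_1,\ldots,\xi_{pr}]\Big/\left(\frac{\partial W_{super}}{\partial u_i},\ \frac{\partial W_{super}}{\partial \xi_i}\ :\ 1\le i\le pr\right),$$ where the class of $\xi_i$ corresponds to $du_i$.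
   Context: $\mathrm{Coef}_N[f(z)]$ denotes the coefficient of $z^N$ in the formal power series $f(z)$. For a polynomial $U(z)$ with constant term $1$ and a rational number $s$, the power $U(z)^s$ is the formal power series in $z$ with constant term $1$ given by the binomial expansion. $\mathbb{C}[u_1,\ldots,u_{pr},\xi_1,\ldots,\xi_{pr}]$ is the free supercommutative algebra, i.e. the polynomial algebra in the $u_i$ tensored with the exterior algebra in the $\xi_i$; the partial derivatives of $W_{super}$ (which is linear in the $\xi_i$) are $\frac{\partial W_{super}}{\partial \xi_i}=\frac{\partial W}{\partial u_i}$ and $\frac{\partial W_{super}}{\partial u_i}=\sum_j \frac{\partial^2 W}{\partial u_i\partial u_j}\xi_j$. For an affine $\mathbb{C}$-scheme $M=\mathrm{Spec}\,A$ (possibly non-reduced), $\Omega^{\bullet}(M)$ denotes the algebra of differential forms, i.e. the exterior algebra over $A$ of the module of Kähler differentials $\Omega^1_{A/\mathbb{C}}$. *)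

(* Defs.v *)
From HB Require Import structures.
From mathcomp Require Import all_boot all_order all_algebra.
From mathcomp Require Import generic_quotient ring_quotient boolp reals.
From mathcomp Require Import complex.
From mathcomp Require Import mpoly.

Set Implicit Arguments.
Unset Strict Implicit.
Unset Printing Implicit Defensive.

Import GRing.Theory.
Local Open Scope ring_scope.
Local Open Scope quotient_scope.

(* All rings below are allowed to be zero (pzRingType), so that quotients by
   arbitrary ideals are available.  Since MathComp's algType excludes the zero
   ring, an algebra over a commutative ring is represented by its structure
   morphism. *)

Section IdealGen.
Variables (R : pzRingType) (G : R -> Prop).

Inductive ideal_gen : R -> Prop :=
| IdealGen x of G x : ideal_gen x
| Ideal0 : ideal_gen 0
| IdealB x y of ideal_gen x & ideal_gen y : ideal_gen (x - y)
| IdealMl a x of ideal_gen x : ideal_gen (a * x)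
| IdealMr a x of ideal_gen x : ideal_gen (x * a).

Definition idealb (x : R) : bool := `[< ideal_gen x >].

Fact idealb_zmod_closed : zmod_closed idealb.
Proof.
split; first exact/asboolP/Ideal0.
by move=> x y /asboolP hx /asboolP hy; apply/asboolP/IdealB.
Qed.

HB.instance Definition _ := GRing.isZmodClosed.Build R idealb idealb_zmod_closed.

Let idealz : zmodClosed R := GRing.ZmodClosed.clone R idealb _.

Definition quot_ring : Type := Quotient.quot idealz.
HB.instance Definition _ := GRing.Zmodule.on quot_ring.
HB.instance Definition _ : EqQuotient R (Quotient.equiv idealz) quot_ring :=
  EqQuotient.on quot_ring.

Definition quot_proj (x : R) : quot_ring := \pi_(Quotient.quot idealz) x.

Lemma quot_projP x y : quot_proj x = quot_proj y <-> ideal_gen (x - y).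
Proof.
by split=> [/eqP|h]; [|apply/eqP];
  rewrite /quot_proj -Quotient.idealrBE; [move/asboolP | apply/asboolP].
Qed.

Lemma quot_projK (x : quot_ring) : quot_proj (repr x) = x.
Proof. exact: reprK. Qed.

Fact quot_proj_is_zmod_morphism : zmod_morphism quot_proj.
Proof. by move=> x y; rewrite /quot_proj; exact: (raddfB \pi_(Quotient.quot idealz)). Qed.

HB.instance Definition _ :=
  GRing.isZmodMorphism.Build R quot_ring quot_proj quot_proj_is_zmod_morphism.

Let one := quot_proj 1.
Let mul (x y : quot_ring) := quot_proj (repr x * repr y).

Let mulE x y : mul (quot_proj x) (quot_proj y) = quot_proj (x * y).
Proof.
apply/quot_projP; set x' := repr _; set y' := repr _.
have hx : ideal_gen (x' - x) by apply/quot_projP; rewrite quot_projK.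
have hy : ideal_gen (y' - y) by apply/quot_projP; rewrite quot_projK.
have -> : x' * y' - x * y = (x' - x) * y' - (x * (y - y')).
  by rewrite mulrBl mulrBr opprB addrA subrK.
apply: IdealB; first exact: IdealMr.
by apply: IdealMl; rewrite -opprB -sub0r; apply: IdealB => //; exact: Ideal0.
Qed.

Fact quot_mulA : associative mul.
Proof.
move=> x y z; rewrite -[x]quot_projK -[y]quot_projK -[z]quot_projK.
by rewrite !mulE mulrA.
Qed.
Fact quot_mul1 : left_id one mul.
Proof. by move=> x; rewrite -[x]quot_projK mulE mul1r. Qed.
Fact quot_1mul : right_id one mul.
Proof. by move=> x; rewrite -[x]quot_projK mulE mulr1. Qed.
Fact quot_mulDl : left_distributive mul +%R.
Proof.
move=> x y z; rewrite -[x]quot_projK -[y]quot_projK -[z]quot_projK.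
by rewrite -raddfD !mulE mulrDl raddfD.
Qed.
Fact quot_mulDr : right_distributive mul +%R.
Proof.
move=> x y z; rewrite -[x]quot_projK -[y]quot_projK -[z]quot_projK.
by rewrite -raddfD !mulE mulrDr raddfD.
Qed.

HB.instance Definition _ := GRing.Zmodule_isPzRing.Build quot_ring
  quot_mulA quot_mul1 quot_1mul quot_mulDl quot_mulDr.

Fact quot_proj_is_monoid_morphism : monoid_morphism quot_proj.
Proof. by split=> // x y; rewrite -mulE. Qed.

HB.instance Definition _ :=
  GRing.isMonoidMorphism.Build R quot_ring quot_proj
    quot_proj_is_monoid_morphism.

End IdealGen.

Section ComQuot.
Variables (R : comPzRingType) (G : R -> Prop).

Fact quot_mulC : commutative (@GRing.mul (quot_ring G)).
Proof.
move=> x y; rewrite -[x]quot_projK -[y]quot_projK.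
by rewrite -!rmorphM mulrC.
Qed.

HB.instance Definition _ :=
  GRing.PzRing_hasCommutativeMul.Build (quot_ring G) quot_mulC.
End ComQuot.

(* The module of Kaehler differentials of the k-algebra A: the A-module generated
   by symbols d a (a in A) subject to d (a + b) = d a + d b,
   d (a b) = a d b + b d a and d c = 0 for c in k.  It is the quotient of the
   module expressions in these symbols by the least congruence krel containing
   the A-module axioms and the three relations on d. *)

Section Kahler.
Variables (k A : comPzRingType) (eta : {rmorphism k -> A}).

Inductive kterm : Type :=
| KD of A
| K0
| KAdd of kterm & kterm
| KOpp of kterm
| KScale of A & kterm.

HB.instance Definition _ := gen_eqMixin kterm.
HB.instance Definition _ := gen_choiceMixin kterm.

Inductive krel : kterm -> kterm -> Prop :=
| KR_refl s : krel s s
| KR_sym s t of krel s t : krel t s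
| KR_trans s t u of krel s t & krel t u : krel s u
| KR_add s s' t t' of krel s s' & krel t t' : krel (KAdd s t) (KAdd s' t')
| KR_opp s s' of krel s s' : krel (KOpp s) (KOpp s')
| KR_scale a s s' of krel s s' : krel (KScale a s) (KScale a s')
| KR_addA s t u : krel (KAdd s (KAdd t u)) (KAdd (KAdd s t) u)
| KR_addC s t : krel (KAdd s t) (KAdd t s)
| KR_add0 s : krel (KAdd K0 s) s
| KR_addN s : krel (KAdd (KOpp s) s) K0
| KR_scaleA a b s : krel (KScale a (KScale b s)) (KScale (a * b) s)
| KR_scale1 s : krel (KScale 1 s) s
| KR_scaleDr a s t : krel (KScale a (KAdd s t)) (KAdd (KScale a s) (KScale a t))
| KR_scaleDl s a b : krel (KScale (a + b) s) (KAdd (KScale a s) (KScale b s))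
| KR_dD a b : krel (KD (a + b)) (KAdd (KD a) (KD b))
| KR_dM a b : krel (KD (a * b)) (KAdd (KScale a (KD b)) (KScale b (KD a)))
| KR_dC c : krel (KD (eta c)) K0.

Definition krelb (s t : kterm) : bool := `[< krel s t >].

Fact krelb_refl : reflexive krelb.
Proof. by move=> s; exact/asboolP/KR_refl. Qed.
Fact krelb_sym : ssrbool.symmetric krelb.
Proof. by move=> s t; apply/asbool_equiv_eq; split; exact: KR_sym. Qed.
Fact krelb_trans : transitive krelb.
Proof.
by move=> t s u /asboolP h1 /asboolP h2; apply/asboolP/(KR_trans h1 h2).
Qed.
Canonical krel_equiv := EquivRel krelb krelb_refl krelb_sym krelb_trans.

Definition kahler : Type := {eq_quot krel_equiv}.
HB.instance Definition _ := Choice.on kahler.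
HB.instance Definition _ : EqQuotient kterm krel_equiv kahler :=
  EqQuotient.on kahler.

Definition kclass (s : kterm) : kahler := \pi_kahler s.

Lemma kclassP s t : kclass s = kclass t <-> krel s t.
Proof.
by split=> [/eqP|h]; [|apply/eqP]; rewrite /kclass piE /=;
  [move/asboolP | apply/asboolP].
Qed.

Lemma kclassK (x : kahler) : kclass (repr x) = x.
Proof. exact: reprK. Qed.

Lemma krepr s : krel (repr (kclass s)) s.
Proof. by apply/kclassP; rewrite kclassK. Qed.

Let add (x y : kahler) := kclass (KAdd (repr x) (repr y)).
Let opp (x : kahler) := kclass (KOpp (repr x)).
Let scale (a : A) (x : kahler) := kclass (KScale a (repr x)).

Let addE s t : add (kclass s) (kclass t) = kclass (KAdd s t).
Proof. by apply/kclassP/KR_add; exact: krepr. Qed.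
Let oppE s : opp (kclass s) = kclass (KOpp s).
Proof. by apply/kclassP/KR_opp; exact: krepr. Qed.
Let scaleE a s : scale a (kclass s) = kclass (KScale a s).
Proof. by apply/kclassP/KR_scale; exact: krepr. Qed.

Fact kaddA : associative add.
Proof.
move=> x y z; rewrite -[x]kclassK -[y]kclassK -[z]kclassK !addE.
exact/kclassP/KR_addA.
Qed.
Fact kaddC : commutative add.
Proof.
by move=> x y; rewrite -[x]kclassK -[y]kclassK !addE; exact/kclassP/KR_addC.
Qed.
Fact kadd0 : left_id (kclass K0) add.
Proof. by move=> x; rewrite -[x]kclassK addE; exact/kclassP/KR_add0. Qed.
Fact kaddN : left_inverse (kclass K0) opp add.
Proof. by move=> x; rewrite -[x]kclassK oppE addE; exact/kclassP/KR_addN. Qed.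

HB.instance Definition _ :=
  GRing.isZmodule.Build kahler kaddA kaddC kadd0 kaddN.

Fact kscaleA a b x : scale a (scale b x) = scale (a * b) x.
Proof. by rewrite -[x]kclassK !scaleE; exact/kclassP/KR_scaleA. Qed.
Fact kscale1 : left_id 1 scale.
Proof. by move=> x; rewrite -[x]kclassK scaleE; exact/kclassP/KR_scale1. Qed.
Fact kscaleDr : right_distributive scale +%R.
Proof.
move=> a x y; rewrite -[x]kclassK -[y]kclassK.
by rewrite [LHS](congr1 _ (addE _ _)) !scaleE [RHS]addE; exact/kclassP/KR_scaleDr.
Qed.
Fact kscaleDl x : {morph scale^~ x : a b / a + b}.
Proof.
move=> a b; rewrite -[x]kclassK !scaleE [RHS]addE; exact/kclassP/KR_scaleDl.
Qed.

HB.instance Definition _ := GRing.Zmodule_isLmodule.Build A kahler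
  kscaleA kscale1 kscaleDr kscaleDl.

Definition kd (a : A) : kahler := kclass (KD a).

Lemma kdD a b : kd (a + b) = kd a + kd b.
Proof. by rewrite [RHS]addE; exact/kclassP/KR_dD. Qed.
Lemma kdM a b : kd (a * b) = a *: kd b + b *: kd a.
Proof.
rewrite [X in _ = X + _]scaleE [X in _ = _ + X]scaleE [RHS]addE.
exact/kclassP/KR_dM.
Qed.
Lemma kdC c : kd (eta c) = 0.
Proof. exact/kclassP/KR_dC. Qed.

End Kahler.

(* The exterior algebra of M over A: the associative unital A-algebra generated
   by the module M subject to m * m = 0.  It is the quotient of the algebra
   expressions in elements of A and M by the least congruence erel containing
   the A-algebra axioms (the zero and the unit being the scalars 0 and 1 of A),
   the A-linearity of the inclusion of M, and m * m = 0. *)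

Section Exterior.
Variables (A : comPzRingType) (M : lmodType A).

Inductive eterm : Type :=
| EScal of A
| EGen of M
| EAdd of eterm & eterm
| EOpp of eterm
| EMul of eterm & eterm.

HB.instance Definition _ := gen_eqMixin eterm.
HB.instance Definition _ := gen_choiceMixin eterm.

Inductive erel : eterm -> eterm -> Prop :=
| ER_refl s : erel s s
| ER_sym s t of erel s t : erel t s
| ER_trans s t u of erel s t & erel t u : erel s u
| ER_add s s' t t' of erel s s' & erel t t' : erel (EAdd s t) (EAdd s' t')
| ER_opp s s' of erel s s' : erel (EOpp s) (EOpp s')
| ER_mul s s' t t' of erel s s' & erel t t' : erel (EMul s t) (EMul s' t')
| ER_addA s t u : erel (EAdd s (EAdd t u)) (EAdd (EAdd s t) u)
| ER_addC s t : erel (EAdd s t) (EAdd t s)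
| ER_add0 s : erel (EAdd (EScal 0) s) s
| ER_addN s : erel (EAdd (EOpp s) s) (EScal 0)
| ER_mulA s t u : erel (EMul s (EMul t u)) (EMul (EMul s t) u)
| ER_mul1 s : erel (EMul (EScal 1) s) s
| ER_mulDl s t u : erel (EMul (EAdd s t) u) (EAdd (EMul s u) (EMul t u))
| ER_mulDr s t u : erel (EMul s (EAdd t u)) (EAdd (EMul s t) (EMul s u))
| ER_scalD a b : erel (EScal (a + b)) (EAdd (EScal a) (EScal b))
| ER_scalM a b : erel (EScal (a * b)) (EMul (EScal a) (EScal b))
| ER_scalC a s : erel (EMul (EScal a) s) (EMul s (EScal a))
| ER_genD m n : erel (EGen (m + n)) (EAdd (EGen m) (EGen n))
| ER_genZ a m : erel (EGen (a *: m)) (EMul (EScal a) (EGen m))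
| ER_sq m : erel (EMul (EGen m) (EGen m)) (EScal 0).

Definition erelb (s t : eterm) : bool := `[< erel s t >].

Fact erelb_refl : reflexive erelb.
Proof. by move=> s; exact/asboolP/ER_refl. Qed.
Fact erelb_sym : ssrbool.symmetric erelb.
Proof. by move=> s t; apply/asbool_equiv_eq; split; exact: ER_sym. Qed.
Fact erelb_trans : transitive erelb.
Proof.
by move=> t s u /asboolP h1 /asboolP h2; apply/asboolP/(ER_trans h1 h2).
Qed.
Canonical erel_equiv := EquivRel erelb erelb_refl erelb_sym erelb_trans.

Definition ext : Type := {eq_quot erel_equiv}.
HB.instance Definition _ := Choice.on ext.
HB.instance Definition _ : EqQuotient eterm erel_equiv ext := EqQuotient.on ext.

Definition eclass (s : eterm) : ext := \pi_ext s.

Lemma eclassP s t : eclass s = eclass t <-> erel s t.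
Proof.
by split=> [/eqP|h]; [|apply/eqP]; rewrite /eclass piE /=;
  [move/asboolP | apply/asboolP].
Qed.

Lemma eclassK (x : ext) : eclass (repr x) = x.
Proof. exact: reprK. Qed.

Lemma erepr s : erel (repr (eclass s)) s.
Proof. by apply/eclassP; rewrite eclassK. Qed.

Let add (x y : ext) := eclass (EAdd (repr x) (repr y)).
Let opp (x : ext) := eclass (EOpp (repr x)).
Let mul (x y : ext) := eclass (EMul (repr x) (repr y)).

Let addE s t : add (eclass s) (eclass t) = eclass (EAdd s t).
Proof. by apply/eclassP/ER_add; exact: erepr. Qed.
Let oppE s : opp (eclass s) = eclass (EOpp s).
Proof. by apply/eclassP/ER_opp; exact: erepr. Qed.
Let mulE s t : mul (eclass s) (eclass t) = eclass (EMul s t).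
Proof. by apply/eclassP/ER_mul; exact: erepr. Qed.

Fact eaddA : associative add.
Proof.
move=> x y z; rewrite -[x]eclassK -[y]eclassK -[z]eclassK !addE.
exact/eclassP/ER_addA.
Qed.
Fact eaddC : commutative add.
Proof.
by move=> x y; rewrite -[x]eclassK -[y]eclassK !addE; exact/eclassP/ER_addC.
Qed.
Fact eadd0 : left_id (eclass (EScal 0)) add.
Proof. by move=> x; rewrite -[x]eclassK addE; exact/eclassP/ER_add0. Qed.
Fact eaddN : left_inverse (eclass (EScal 0)) opp add.
Proof. by move=> x; rewrite -[x]eclassK oppE addE; exact/eclassP/ER_addN. Qed.

HB.instance Definition _ := GRing.isZmodule.Build ext eaddA eaddC eadd0 eaddN.

Fact emulA : associative mul.
Proof.
move=> x y z; rewrite -[x]eclassK -[y]eclassK -[z]eclassK !mulE.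
exact/eclassP/ER_mulA.
Qed.
Fact emul1 : left_id (eclass (EScal 1)) mul.
Proof. by move=> x; rewrite -[x]eclassK mulE; exact/eclassP/ER_mul1. Qed.
Fact e1mul : right_id (eclass (EScal 1)) mul.
Proof.
move=> x; rewrite -[x]eclassK mulE; apply/eclassP.
exact: ER_trans (ER_sym (ER_scalC _ _)) (ER_mul1 _).
Qed.
Fact emulDl : left_distributive mul +%R.
Proof.
move=> x y z; rewrite -[x]eclassK -[y]eclassK -[z]eclassK.
by rewrite [X in mul X _]addE !mulE [RHS]addE; exact/eclassP/ER_mulDl.
Qed.
Fact emulDr : right_distributive mul +%R.
Proof.
move=> x y z; rewrite -[x]eclassK -[y]eclassK -[z]eclassK.
by rewrite [X in mul _ X]addE !mulE [RHS]addE; exact/eclassP/ER_mulDr.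
Qed.

HB.instance Definition _ := GRing.Zmodule_isPzRing.Build ext
  emulA emul1 e1mul emulDl emulDr.

Lemma eclassD s t : eclass (EAdd s t) = eclass s + eclass t.
Proof. by rewrite [RHS]addE. Qed.
Lemma eclassN s : eclass (EOpp s) = - eclass s.
Proof. by rewrite [RHS]oppE. Qed.
Lemma eclassM s t : eclass (EMul s t) = eclass s * eclass t.
Proof. by rewrite [RHS]mulE. Qed.

Definition ext_scal (a : A) : ext := eclass (EScal a).

Fact ext_scal_is_nmod_morphism : nmod_morphism ext_scal.
Proof.
by split=> // a b; rewrite /ext_scal -eclassD; exact/eclassP/ER_scalD.
Qed.
Fact ext_scal_is_monoid_morphism : monoid_morphism ext_scal.
Proof.
by split=> // a b; rewrite /ext_scal -eclassM; exact/eclassP/ER_scalM.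
Qed.

HB.instance Definition _ :=
  GRing.isNmodMorphism.Build A ext ext_scal ext_scal_is_nmod_morphism.
HB.instance Definition _ :=
  GRing.isMonoidMorphism.Build A ext ext_scal ext_scal_is_monoid_morphism.

Definition ext_gen (m : M) : ext := eclass (EGen m).

Lemma ext_scalC a x : ext_scal a * x = x * ext_scal a.
Proof. by rewrite -[x]eclassK -!eclassM; exact/eclassP/ER_scalC. Qed.
Lemma ext_genD m n : ext_gen (m + n) = ext_gen m + ext_gen n.
Proof. by rewrite -eclassD; exact/eclassP/ER_genD. Qed.
Lemma ext_genZ a m : ext_gen (a *: m) = ext_scal a * ext_gen m.
Proof. by rewrite -eclassM; exact/eclassP/ER_genZ. Qed.
Lemma ext_gen_sq m : ext_gen m * ext_gen m = 0.
Proof. by rewrite -eclassM; exact/eclassP/ER_sq. Qed.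

Lemma ext_genC m n : ext_gen m * ext_gen n + ext_gen n * ext_gen m = 0.
Proof.
have := ext_gen_sq (m + n); rewrite ext_genD mulrDl !mulrDr !ext_gen_sq.
by rewrite add0r addr0.
Qed.

(* The parity involution: the algebra automorphism equal to -1 on M. *)
Fixpoint parity_term (s : eterm) : ext :=
  match s with
  | EScal a => ext_scal a
  | EGen m => - ext_gen m
  | EAdd s t => parity_term s + parity_term t
  | EOpp s => - parity_term s
  | EMul s t => parity_term s * parity_term t
  end.

Fact parity_termP s t : erel s t -> parity_term s = parity_term t.
Proof.
elim=> {s t} //=.
- by move=> s t u _ -> _ ->.
- by move=> s s' t t' _ -> _ ->.
- by move=> s s' _ ->.
- by move=> s s' t t' _ -> _ ->.
- by move=> *; rewrite addrA.
- by move=> *; rewrite addrC.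
- by move=> s; rewrite rmorph0 add0r.
- by move=> s; rewrite rmorph0 addNr.
- by move=> *; rewrite mulrA.
- by move=> s; rewrite rmorph1 mul1r.
- by move=> *; rewrite mulrDl.
- by move=> *; rewrite mulrDr.
- by move=> *; rewrite rmorphD.
- by move=> *; rewrite rmorphM.
- by move=> *; rewrite ext_scalC.
- by move=> *; rewrite ext_genD opprD.
- by move=> *; rewrite ext_genZ mulrN.
- by move=> m; rewrite mulrNN ext_gen_sq rmorph0.
Qed.

Definition parity (x : ext) : ext := parity_term (repr x).

Lemma parityE s : parity (eclass s) = parity_term s.
Proof. exact/parity_termP/erepr. Qed.

End Exterior.

(* The algebra of differential forms on Spec A over k, eta : k -> A being the
   structure morphism. *)
Definition Omega (k A : comPzRingType) (eta : {rmorphism k -> A}) : pzRingType :=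
  ext (kahler eta).

Definition Omega_fun (k A : comPzRingType) (eta : {rmorphism k -> A}) (a : A) :
  Omega eta := ext_scal (kahler eta) a.

Definition Omega_d (k A : comPzRingType) (eta : {rmorphism k -> A}) (a : A) :
  Omega eta := ext_gen (kd eta a).

Section SuperPoly.
Variables (K : comNzRingType) (n : nat).
Local Notation P := {mpoly K[n]}.

(* K[u_1..u_n] tensored with the exterior algebra on xi_1..xi_n is the exterior
   algebra over K[u_1..u_n] of the free module with basis xi_1..xi_n. *)
Definition superpoly : pzRingType := ext 'rV[P]_n.

Definition sp_even (f : P) : superpoly := ext_scal 'rV[P]_n f.
HB.instance Definition _ := GRing.RMorphism.copy sp_even (ext_scal 'rV[P]_n).

Definition sp_xi (i : 'I_n) : superpoly := ext_gen (delta_mx 0 i : 'rV[P]_n).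

Implicit Types (s t : eterm 'rV[P]_n) (x y : superpoly).

(* d/du_i: the even derivation with u_j |-> delta_ij and xi_j |-> 0. *)
Fixpoint sp_du_term (i : 'I_n) s : superpoly :=
  match s with
  | EScal f => ext_scal _ f^`M(i)
  | EGen m => ext_gen (map_mx (mderiv i) m)
  | EAdd s t => sp_du_term i s + sp_du_term i t
  | EOpp s => - sp_du_term i s
  | EMul s t => sp_du_term i s * eclass t + eclass s * sp_du_term i t
  end.

Fact sp_du_termP i s t : erel s t -> sp_du_term i s = sp_du_term i t.
Proof.
elim=> {s t} //=.
- by move=> s t u _ -> _ ->.
- by move=> s s' t t' _ -> _ ->.
- by move=> s s' _ ->.
- by move=> s s' t t' /eclassP -> -> /eclassP -> ->.
- by move=> *; rewrite addrA.
- by move=> *; rewrite addrC.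
- by move=> s; rewrite mderiv0 rmorph0 add0r.
- by move=> s; rewrite mderiv0 rmorph0 addNr.
- by move=> s t u; rewrite !eclassM mulrDr mulrDl !mulrA !addrA.
- move=> s; rewrite -mpolyC1 mderivC rmorph0 mul0r add0r mpolyC1.
  by rewrite -/(ext_scal _ _) rmorph1 mul1r.
- by move=> s t u; rewrite !eclassD !mulrDl addrACA.
- by move=> s t u; rewrite !eclassD !mulrDr addrACA.
- by move=> *; rewrite mderivD rmorphD.
- by move=> *; rewrite mderivM rmorphD !rmorphM.
- move=> a s; rewrite -!/(ext_scal _ _) ext_scalC addrC.
  by congr (_ + _); rewrite ext_scalC.
- by move=> m m'; rewrite map_mxD ext_genD.
- move=> a m; rewrite -!/(ext_scal _ _) -!/(ext_gen _) -!ext_genZ -ext_genD.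
  by congr ext_gen; apply/rowP=> j; rewrite !mxE mderivM.
- by move=> m; rewrite -!/(ext_gen _) ext_genC mderiv0 rmorph0.
Qed.

Definition sp_du (i : 'I_n) x : superpoly := sp_du_term i (repr x).

Lemma sp_duE i s : sp_du i (eclass s) = sp_du_term i s.
Proof. exact/sp_du_termP/erepr. Qed.

Lemma sp_duD i x y : sp_du i (x + y) = sp_du i x + sp_du i y.
Proof. by rewrite -[x]eclassK -[y]eclassK -eclassD !sp_duE. Qed.
Lemma sp_duM i x y : sp_du i (x * y) = sp_du i x * y + x * sp_du i y.
Proof. by rewrite -[x]eclassK -[y]eclassK -eclassM !sp_duE. Qed.
Lemma sp_du_even i f : sp_du i (sp_even f) = sp_even f^`M(i).
Proof. exact: sp_duE. Qed.
Lemma sp_du_xi i j : sp_du i (sp_xi j) = 0.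
Proof.
rewrite /sp_du /sp_xi; rewrite [LHS]sp_duE /=.
have -> : map_mx (mderiv i) (delta_mx 0 j : 'rV[P]_n) = 0 *: 0.
  by apply/rowP=> l; rewrite !mxE mulr0 -mpolyC_nat mderivC.
by rewrite ext_genZ rmorph0 mul0r.
Qed.

(* d/dxi_i: the odd (left) derivation with u_j |-> 0 and xi_j |-> delta_ij. *)
Fixpoint sp_dxi_term (i : 'I_n) s : superpoly :=
  match s with
  | EScal _ => 0
  | EGen m => ext_scal _ (m 0 i)
  | EAdd s t => sp_dxi_term i s + sp_dxi_term i t
  | EOpp s => - sp_dxi_term i s
  | EMul s t => sp_dxi_term i s * eclass t + parity_term s * sp_dxi_term i t
  end.

Fact sp_dxi_termP i s t : erel s t -> sp_dxi_term i s = sp_dxi_term i t.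
Proof.
elim=> {s t} //=.
- by move=> s t u _ -> _ ->.
- by move=> s s' t t' _ -> _ ->.
- by move=> s s' _ ->.
- by move=> s s' t t' h -> /eclassP -> ->; rewrite (parity_termP h).
- by move=> *; rewrite addrA.
- by move=> *; rewrite addrC.
- by move=> s; rewrite add0r.
- by move=> s; rewrite addNr.
- by move=> s t u; rewrite !eclassM mulrDr mulrDl !mulrA !addrA.
- by move=> s; rewrite mul0r add0r rmorph1 mul1r.
- by move=> s t u; rewrite !mulrDl addrACA.
- by move=> s t u; rewrite !eclassD !mulrDr addrACA.
- by rewrite addr0.
- by move=> *; rewrite mul0r mulr0 addr0.
- by move=> a s; rewrite mul0r mulr0 add0r addr0 -/(ext_scal _ _) ext_scalC.
- by move=> m m'; rewrite mxE rmorphD.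
- by move=> a m; rewrite mxE mul0r add0r rmorphM.
- by move=> m; rewrite -!/(ext_gen _) mulNr ext_scalC subrr.
Qed.

Definition sp_dxi (i : 'I_n) x : superpoly := sp_dxi_term i (repr x).

Lemma sp_dxiE i s : sp_dxi i (eclass s) = sp_dxi_term i s.
Proof. exact/sp_dxi_termP/erepr. Qed.

Lemma sp_dxiD i x y : sp_dxi i (x + y) = sp_dxi i x + sp_dxi i y.
Proof. by rewrite -[x]eclassK -[y]eclassK -eclassD !sp_dxiE. Qed.
Lemma sp_dxiM i x y :
  sp_dxi i (x * y) = sp_dxi i x * y + parity x * sp_dxi i y.
Proof. by rewrite -[x]eclassK -[y]eclassK -eclassM !sp_dxiE parityE. Qed.
Lemma sp_dxi_even i f : sp_dxi i (sp_even f) = 0.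
Proof. exact: sp_dxiE. Qed.
Lemma sp_dxi_xi i j : sp_dxi i (sp_xi j) = (i == j)%:R.
Proof.
by rewrite /sp_xi [LHS]sp_dxiE /= mxE eqxx /= rmorph_nat.
Qed.

Definition jacobi_gens (F : superpoly) (x : superpoly) : Prop :=
  exists i : 'I_n, x = sp_du i F \/ x = sp_dxi i F.

Definition jacobi_ring (F : superpoly) : pzRingType := quot_ring (jacobi_gens F).

Definition jacobi_class (F x : superpoly) : jacobi_ring F :=
  quot_proj (jacobi_gens F) x.

Definition superpotential (W : P) : superpoly :=
  \sum_(i < n) sp_even W^`M(i) * sp_xi i.

Lemma sp_dxi_superpotential i W :
  sp_dxi i (superpotential W) = sp_even W^`M(i).
Proof.
have dxi0 : sp_dxi i 0 = 0 by rewrite -(rmorph0 sp_even) sp_dxi_even.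
rewrite /superpotential (big_morph _ (sp_dxiD i) dxi0) (bigD1 i) //=.
rewrite sp_dxiM sp_dxi_even mul0r add0r sp_dxi_xi eqxx mulr1 /parity.
rewrite [parity_term _]parityE /= big1 ?addr0 // => j /negPf ji.
by rewrite sp_dxiM sp_dxi_even mul0r add0r sp_dxi_xi eq_sym ji mulr0.
Qed.

Lemma sp_du_superpotential i W :
  sp_du i (superpotential W) = \sum_(j < n) sp_even W^`M(j)^`M(i) * sp_xi j.
Proof.
have du0 : sp_du i 0 = 0 by rewrite -(rmorph0 sp_even) sp_du_even mderiv0.
rewrite /superpotential (big_morph _ (sp_duD i) du0); apply: eq_bigr=> j _.
by rewrite sp_duM sp_du_even sp_du_xi mulr0 addr0.
Qed.

End SuperPoly.

Definition gbinom (s : rat) (k : nat) : rat :=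
  (\prod_(i < k) (s - i%:R)) / (k`!)%:R.

(* Coef_N [U(z)^s] for U(z) with constant term 1.  In the binomial expansion
   U^s = sum_k binom(s,k) (U - 1)^k the terms with k > N do not contribute to
   z^N, since z divides U - 1. *)
Definition coef_pow (K : unitRingType) (A : lalgType K) (N : nat) (U : {poly A})
    (s : rat) : A :=
  \sum_(k < N.+1) ratr (gbinom s k) *: ((U - 1) ^+ k)`_N.

(* 1 + u_1 z + ... + u_n z^n, with u_(i+1) = u i. *)
Definition poly1 (A : nzRingType) (n : nat) (u : 'I_n -> A) : {poly A} :=
  1 + \sum_(i < n) u i *: 'X^(i.+1).

Section Model.
Variables (R : realType) (p q r : nat).
Local Notation C := R[i].
(* The first p * r variables are the u's, the last q * r are the v's. *)
Local Notation S := {mpoly C[p * r + q * r]}.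

Definition Mpqr_u (i : 'I_(p * r)) : S := 'X_(lshift (q * r) i).
Definition Mpqr_v (j : 'I_(q * r)) : S := 'X_(rshift (p * r) j).

Definition Mpqr_eqs (f : S) : Prop :=
  exists N : nat, f = (poly1 Mpqr_u ^+ q - poly1 Mpqr_v ^+ p)`_N.

(* An affine scheme is represented by its coordinate ring. *)
Definition Mpqr : comPzRingType := quot_ring Mpqr_eqs.

Definition Mpqr_class (f : S) : Mpqr := quot_proj Mpqr_eqs f.
HB.instance Definition _ := GRing.RMorphism.copy Mpqr_class (quot_proj Mpqr_eqs).

Definition Mpqr_const : {rmorphism C -> Mpqr} :=
  Mpqr_class \o @mpolyC (p * r + q * r) C.

Definition potential : {mpoly C[p * r]} :=
  coef_pow ((p + q) * r).+1%N (poly1 (fun i : 'I_(p * r) => 'X_i))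
    ((q + p)%:R / p%:R).

Definition Wsuper : superpoly C (p * r) := superpotential potential.

End Model.

(* Main.v *)
(* Put U = 1 + u_1 z + ... and T = U^(q/p).  The coefficients of T are the unique
   solution of p U T' = q U' T with constant term 1, also modulo any ideal, and
   the same equation, with constant term 1, characterizes V^p = U^q.  Hence the
   equations of the scheme say that v_j is the coefficient of z^j in T and that
   the coefficients of T in degrees qr+1, ..., (p+q)r vanish (the equation then
   kills the higher ones).  Up to the factor (p+q)/p these coefficients are the
   partial derivatives of W, so the scheme is the critical locus of W.  The
   forms on the critical locus of W are those on the affine space modulo the
   dW/du_i and the d(dW/du_i), which is the Jacobi ring of the superpotential. *)

Require Import Defs.
From HB Require Import structures.
From mathcomp Require Import all_boot all_order all_algebra.
From mathcomp Require Import boolp reals.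
From mathcomp Require Import complex.
From mathcomp Require Import mpoly.
From mathcomp Require Import ring.

Set Implicit Arguments.
Unset Strict Implicit.
Unset Printing Implicit Defensive.

Import GRing.Theory Num.Theory.
Local Open Scope ring_scope.

(** * Universal properties *)

(** The value at [a] is read off a chosen preimage, and the kernel condition makes the choice
    irrelevant. Any surjection is allowed, so this serves both the quotient map of the Jacobi ring
    and the presentation of the coordinate ring. *)
Lemma rmorph_factor (R A B : pzRingType) (pi : {rmorphism R -> A})
    (f : {rmorphism R -> B}) :
  (forall a, exists x, pi x = a) -> (forall x, pi x = 0 -> f x = 0) ->
  exists g : {rmorphism A -> B}, forall x, g (pi x) = f x.
Proof.
move=> pi_surj ker_pi.
pose g a := f (sval (cid (pi_surj a))).
have gE x : g (pi x) = f x.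
  rewrite /g; case: cid => y /= hy; apply/eqP; rewrite -subr_eq0 -rmorphB.
  by apply/eqP/ker_pi; rewrite rmorphB hy subrr.
have gB : zmod_morphism g.
  move=> a b; have [x <-] := pi_surj a; have [y <-] := pi_surj b.
  by rewrite -rmorphB !gE rmorphB.
have gM : monoid_morphism g.
  split; first by rewrite -(rmorph1 pi) gE rmorph1.
  move=> a b; have [x <-] := pi_surj a; have [y <-] := pi_surj b.
  by rewrite -rmorphM !gE rmorphM.
pose gr : {rmorphism A -> B} := HB.pack g
  (GRing.isZmodMorphism.Build A B g gB) (GRing.isMonoidMorphism.Build A B g gM).
by exists gr.
Qed.

Lemma quot_proj_eq0 (R : pzRingType) (G : R -> Prop) x :
  quot_proj G x = 0 <-> ideal_gen G x.
Proof. by rewrite -(rmorph0 (quot_proj G)) quot_projP subr0. Qed.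

Section ExtLift.
Variables (A : comPzRingType) (M : lmodType A).

Lemma ext_ind (Q : ext M -> Prop) :
  (forall a, Q (ext_scal M a)) -> (forall m, Q (ext_gen m)) ->
  (forall x y, Q x -> Q y -> Q (x + y)) -> (forall x, Q x -> Q (- x)) ->
  (forall x y, Q x -> Q y -> Q (x * y)) -> forall x, Q x.
Proof.
move=> Qs Qg QD QN QM x; rewrite -[x]eclassK.
elim: (repr x) => [a|m|s Qs' t Qt|s Qs'|s Qs' t Qt].
- exact: Qs.
- exact: Qg.
- by rewrite eclassD; apply: QD.
- by rewrite eclassN; apply: QN.
- by rewrite eclassM; apply: QM.
Qed.

Lemma ext_rmorph_eq (B : pzRingType) (f g : {rmorphism ext M -> B}) :
  (forall a, f (ext_scal M a) = g (ext_scal M a)) ->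
  (forall m, f (ext_gen m) = g (ext_gen m)) -> f =1 g.
Proof.
move=> fgs fgm; apply: ext_ind => // [x y|x|x y].
- by rewrite !rmorphD => -> ->.
- by rewrite !rmorphN => ->.
- by rewrite !rmorphM => -> ->.
Qed.

Variables (B : pzRingType) (f : {rmorphism A -> B}) (g : M -> B).
Hypotheses (gD : {morph g : m n / m + n}) (gZ : forall a m, g (a *: m) = f a * g m).
Hypotheses (gC : forall a m, f a * g m = g m * f a) (gg : forall m, g m * g m = 0).

Fixpoint ext_lift_term (s : eterm M) : B :=
  match s with
  | EScal a => f a
  | EGen m => g m
  | EAdd s t => ext_lift_term s + ext_lift_term t
  | EOpp s => - ext_lift_term s
  | EMul s t => ext_lift_term s * ext_lift_term t
  end.

Lemma ext_lift_termP s t : erel s t -> ext_lift_term s = ext_lift_term t.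
Proof.
elim=> {s t} //=.
- by move=> s t u _ -> _ ->.
- by move=> s s' t t' _ -> _ ->.
- by move=> s s' _ ->.
- by move=> s s' t t' _ -> _ ->.
- by move=> *; rewrite addrA.
- by move=> *; rewrite addrC.
- by move=> s; rewrite rmorph0 add0r.
- by move=> s; rewrite rmorph0 addNr.
- by move=> *; rewrite mulrA.
- by move=> s; rewrite rmorph1 mul1r.
- by move=> *; rewrite mulrDl.
- by move=> *; rewrite mulrDr.
- by move=> *; rewrite rmorphD.
- by move=> *; rewrite rmorphM.
(* Scalars must commute with every expression, while [gC] covers generators only; hence an inner
   induction. *)
- move=> a; elim=> //= [b|s hs t ht|s hs|s hs t ht].
  + by rewrite -!rmorphM mulrC.
  + by rewrite mulrDl mulrDr hs ht.
  + by rewrite mulrN mulNr hs.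
  + by rewrite mulrA hs -mulrA ht mulrA.
- by move=> m; rewrite gg rmorph0.
Qed.

(** Universal property of the exterior algebra. As [B] may be noncommutative, [gC] plays the part of
    centrality of the scalars. *)
Lemma ext_lift : exists phi : {rmorphism ext M -> B},
  (forall a, phi (ext_scal M a) = f a) /\ (forall m, phi (ext_gen m) = g m).
Proof.
pose h (x : ext M) := ext_lift_term (repr x).
have hE s : h (eclass s) = ext_lift_term s by exact/ext_lift_termP/erepr.
have hB : zmod_morphism h.
  by move=> x y; rewrite -[x]eclassK -[y]eclassK -eclassN -eclassD !hE.
have hM : monoid_morphism h.
  split; first by rewrite [LHS]hE /= rmorph1.
  by move=> x y; rewrite -[x]eclassK -[y]eclassK -eclassM !hE.
pose hr : {rmorphism ext M -> B} := HB.pack h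
  (GRing.isZmodMorphism.Build _ B h hB) (GRing.isMonoidMorphism.Build _ B h hM).
by exists hr; split=> [a|m]; rewrite [LHS]hE.
Qed.

End ExtLift.

Section KahlerLift.
Variables (k A : comPzRingType) (eta : {rmorphism k -> A}).

Lemma kahler_ind (Q : kahler eta -> Prop) :
  (forall a, Q (kd eta a)) -> Q 0 ->
  (forall x y, Q x -> Q y -> Q (x + y)) -> (forall x, Q x -> Q (- x)) ->
  (forall a x, Q x -> Q (a *: x)) -> forall x, Q x.
Proof.
move=> Qd Q0 QD QN QZ x; rewrite -[x]kclassK.
have kDE s t : kclass eta (KAdd s t) = kclass eta s + kclass eta t.
  by apply/esym/kclassP/KR_add; exact: krepr.
have kNE s : kclass eta (KOpp s) = - kclass eta s.
  by apply/esym/kclassP/KR_opp; exact: krepr.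
have kZE a s : kclass eta (KScale a s) = a *: kclass eta s.
  by apply/esym/kclassP/KR_scale; exact: krepr.
elim: (repr x) => [a||s hs t ht|s hs|a s hs].
- exact: Qd.
- exact: Q0.
- by rewrite kDE; apply: QD.
- by rewrite kNE; apply: QN.
- by rewrite kZE; apply: QZ.
Qed.

Variables (B : pzRingType) (f : {rmorphism A -> B}) (D : A -> B).
Hypotheses (DD : {morph D : a b / a + b}).
Hypotheses (DM : forall a b, D (a * b) = f a * D b + f b * D a).
Hypotheses (DC : forall c, D (eta c) = 0).

Fixpoint kahler_lift_term (s : kterm A) : B :=
  match s with
  | KD a => D a
  | K0 => 0
  | KAdd s t => kahler_lift_term s + kahler_lift_term t
  | KOpp s => - kahler_lift_term s
  | KScale a s => f a * kahler_lift_term s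
  end.

Lemma kahler_lift_termP s t :
  krel eta s t -> kahler_lift_term s = kahler_lift_term t.
Proof.
elim=> {s t} //=.
- by move=> s t u _ -> _ ->.
- by move=> s s' t t' _ -> _ ->.
- by move=> s s' _ ->.
- by move=> a s s' _ ->.
- by move=> *; rewrite addrA.
- by move=> *; rewrite addrC.
- by move=> s; rewrite add0r.
- by move=> s; rewrite addNr.
- by move=> *; rewrite rmorphM mulrA.
- by move=> s; rewrite rmorph1 mul1r.
- by move=> *; rewrite mulrDr.
- by move=> *; rewrite rmorphD mulrDl.
Qed.

(** Universal property of the Kähler differentials. The target is a ring on which [A] acts through
    [f], the form that [ext_lift] takes as input. *)
Lemma kahler_lift : exists g : kahler eta -> B,
  [/\ {morph g : x y / x + y}, forall a x, g (a *: x) = f a * g x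
    & forall a, g (kd eta a) = D a].
Proof.
pose g (x : kahler eta) := kahler_lift_term (repr x).
exists g; have gE s : g (kclass eta s) = kahler_lift_term s.
  exact/kahler_lift_termP/krepr.
split=> [x y|a x|a].
- exact: (gE (KAdd (repr x) (repr y))).
- exact: (gE (KScale a (repr x))).
- exact: gE.
Qed.

End KahlerLift.

Section ExtGen.
Variables (A : comPzRingType) (M : lmodType A).

Lemma ext_gen0 : ext_gen (0 : M) = 0.
Proof. by rewrite -(scale0r 0) ext_genZ rmorph0 mul0r. Qed.

Lemma ext_genN (m : M) : ext_gen (- m) = - ext_gen m.
Proof. by rewrite -scaleN1r ext_genZ rmorphN1 mulN1r. Qed.

Lemma ext_gen_sum (I : finType) (m : I -> M) :
  ext_gen (\sum_i m i) = \sum_i ext_gen (m i).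
Proof. exact: (big_morph _ (@ext_genD A M) ext_gen0). Qed.

End ExtGen.

Lemma mpoly_ring_ind (n : nat) (K : nzRingType) (Q : {mpoly K[n]} -> Prop) :
  (forall c, Q c%:MP) -> (forall i, Q 'X_i) ->
  (forall f g, Q f -> Q g -> Q (f + g)) ->
  (forall f g, Q f -> Q g -> Q (f * g)) -> forall f, Q f.
Proof.
move=> QC QX QD QM; apply: mpolyind => [|c m f _ _ Qf].
  by rewrite -mpolyC0; apply: QC.
apply: (QD) => //; rewrite -mul_mpolyC; apply: (QM); first exact: QC.
rewrite mpolyXE_id; apply: (big_ind Q) => // [|i _].
  by rewrite -mpolyC1; apply: QC.
elim: (m i) => [|d IHd]; first by rewrite expr0 -mpolyC1; apply: QC.
by rewrite exprS; apply: QM.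
Qed.

Lemma mderivXU (n : nat) (K : nzRingType) (i j : 'I_n) :
  ('X_j : {mpoly K[n]})^`M(i) = (i == j)%:R.
Proof.
rewrite mderivX mnm1E eq_sym; case: eqP => [->|_]; last by rewrite scale0r.
rewrite scale1r -mpolyX0; congr 'X_[_].
by apply/mnmP=> l; rewrite !mnmE subnn.
Qed.

(** * Differential forms on a critical locus *)

Section CriticalLocus.
Variables (k : comNzRingType) (n : nat) (A : comPzRingType).
Variables (eta : {rmorphism k -> A}) (pi : {rmorphism {mpoly k[n]} -> A}).
Variable W : {mpoly k[n]}.
Local Notation P := {mpoly k[n]}.
Local Notation J := (jacobi_ring (superpotential W)).
Local Notation cl := (quot_proj (jacobi_gens (superpotential W))).
Let crit (f : P) := exists i, f = W^`M(i).
Hypothesis pi_C : forall c, pi c%:MP = eta c.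
Hypothesis pi_surj : forall a, exists h, pi h = a.
Hypothesis pi_ker : forall h, pi h = 0 <-> ideal_gen crit h.

(** [grad h] is [dh] in the free module on the [xi_j]; [diff] sends [xi_j] to the differential of
    the class of [u_j]. *)
Let grad (h : P) : 'rV[P]_n := \row_j h^`M(j).
Let diff (m : 'rV[P]_n) : kahler eta := \sum_j pi (m 0 j) *: kd eta (pi 'X_j).

Let gradD a b : grad (a + b) = grad a + grad b.
Proof. by apply/rowP=> j; rewrite !mxE mderivD. Qed.

Let gradM a b : grad (a * b) = a *: grad b + b *: grad a.
Proof. by apply/rowP=> j; rewrite !mxE mderivM addrC [_ * b]mulrC. Qed.

Let gradC c : grad c%:MP = 0.
Proof. by apply/rowP=> j; rewrite !mxE mderivC. Qed.

Let gradN a : grad (- a) = - grad a.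
Proof. by apply/rowP=> j; rewrite !mxE mderivN. Qed.

Let gradX i : grad 'X_i = delta_mx 0 i.
Proof. by apply/rowP=> j; rewrite !mxE mderivXU eqxx. Qed.

Let ext_gen_row (m : 'rV[P]_n) :
  ext_gen m = \sum_j sp_even (m 0 j) * sp_xi k j.
Proof.
rewrite {1}(row_sum_delta m) ext_gen_sum; apply: eq_bigr => j _.
exact: ext_genZ.
Qed.

(** Symmetry of the Hessian: the relations [d (dW/du_i) = 0] are the derivatives along the even
    variables. *)
Let ext_gen_gradW i : ext_gen (grad W^`M(i)) = sp_du i (superpotential W).
Proof.
rewrite sp_du_superpotential ext_gen_row; apply: eq_bigr => j _.
by rewrite mxE mderiv_comm.
Qed.

Let ev : {rmorphism P -> J} := cl \o @sp_even k n.

Let cl_even_crit h : ideal_gen crit h -> cl (sp_even h) = 0.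
Proof.
rewrite -[cl _]/(ev h); elim=> {h} [h [i ->]||h g _ Hh _ Hg|a h _ Hh|a h _ Hh].
- apply/quot_proj_eq0/IdealGen; exists i; right.
  by rewrite sp_dxi_superpotential.
- by rewrite !rmorph0.
- by rewrite !rmorphB Hh Hg subrr.
- by rewrite !rmorphM Hh mulr0.
- by rewrite !rmorphM Hh mul0r.
Qed.

(** In the Leibniz rule [d (a h) = a dh + h da] the first term dies by induction, the second because
    [h] itself is zero in the Jacobi ring. *)
Let cl_grad_crit h : ideal_gen crit h -> cl (ext_gen (grad h)) = 0.
Proof.
have clM a b : cl (ext_gen (grad (a * b))) =
    cl (sp_even a) * cl (ext_gen (grad b)) + cl (sp_even b) * cl (ext_gen (grad a)).
  by rewrite gradM ext_genD !ext_genZ rmorphD !rmorphM.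
elim=> {h} [h [i ->]||h g _ Hh _ Hg|a h I_h Hh|a h I_h Hh].
- by apply/quot_proj_eq0/IdealGen; exists i; left; rewrite ext_gen_gradW.
- by rewrite -mpolyC0 gradC ext_gen0 rmorph0.
- by rewrite gradD gradN ext_genD ext_genN rmorphB /= Hh Hg subrr.
- by rewrite clM Hh (cl_even_crit I_h) mulr0 mul0r addr0.
- by rewrite clM Hh (cl_even_crit I_h) mulr0 mul0r addr0.
Qed.

Let diffD m m' : diff (m + m') = diff m + diff m'.
Proof.
by rewrite -big_split; apply: eq_bigr => j _; rewrite mxE rmorphD scalerDl.
Qed.

Let diffZ a m : diff (a *: m) = pi a *: diff m.
Proof.
by rewrite scaler_sumr; apply: eq_bigr => j _; rewrite mxE rmorphM scalerA.
Qed.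

Let diff_delta i : diff (delta_mx 0 i) = kd eta (pi 'X_i).
Proof.
rewrite /diff (bigD1 i) //= mxE !eqxx rmorph1 scale1r big1 ?addr0 // => j ji.
by rewrite mxE (negPf ji) andbF rmorph0 scale0r.
Qed.

(** Both sides are derivations in [h] that agree on constants and variables. *)
Let diff_grad h : diff (grad h) = kd eta (pi h).
Proof.
elim/mpoly_ring_ind: h => [c|i|f g Hf Hg|f g Hf Hg].
- rewrite pi_C kdC gradC /diff big1 // => j _.
  by rewrite mxE rmorph0 scale0r.
- by rewrite gradX diff_delta.
- by rewrite gradD diffD rmorphD kdD Hf Hg.
- by rewrite gradM diffD !diffZ rmorphM kdM Hf Hg.
Qed.

Lemma jacobi_to_Omega : exists psi : {rmorphism J -> Omega eta},
  (forall h, psi (cl (sp_even h)) = Omega_fun eta (pi h)) /\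
  (forall m, psi (cl (ext_gen m)) = ext_gen (diff m)).
Proof.
pose f' : {rmorphism P -> Omega eta} := ext_scal (kahler eta) \o pi.
have [||||psi0 [psi0s psi0g]] := @ext_lift _ 'rV[P]_n (Omega eta) f'
    (fun m => ext_gen (diff m)).
- by move=> m m'; rewrite diffD ext_genD.
- by move=> a m; rewrite diffZ ext_genZ.
- by move=> a m; rewrite ext_scalC.
- by move=> m; rewrite ext_gen_sq.
have [||psi psiE] := @rmorph_factor _ _ _ cl psi0.
- by move=> a; exists (repr a); exact: quot_projK.
- move=> x /quot_proj_eq0; elim=> {x} [x [i [->|->]]||x y _ Hx _ Hy|a x _ Hx|a x _ Hx].
  (* The class of [dW/du_i] is zero; written as the constant [eta 0], it has zero differential by
     [kdC]. *)
  + rewrite -ext_gen_gradW psi0g diff_grad (_ : pi _ = eta 0) ?kdC ?ext_gen0 //.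
    by rewrite rmorph0; apply/pi_ker/IdealGen; exists i.
  + rewrite sp_dxi_superpotential psi0s /= (_ : pi _ = 0) ?rmorph0 //.
    by apply/pi_ker/IdealGen; exists i.
  + exact: rmorph0.
  + by rewrite rmorphB Hx Hy subrr.
  + by rewrite rmorphM Hx mulr0.
  + by rewrite rmorphM Hx mul0r.
by exists psi; split=> [h|m]; rewrite psiE ?psi0s ?psi0g.
Qed.

Lemma Omega_to_jacobi : exists phi : {rmorphism Omega eta -> J},
  (forall h, phi (Omega_fun eta (pi h)) = cl (sp_even h)) /\
  (forall h, phi (Omega_d eta (pi h)) = cl (ext_gen (grad h))).
Proof.
have [||f fE] := @rmorph_factor _ _ _ pi ev.
- exact: pi_surj.
- by move=> h /pi_ker /cl_even_crit.
(* Differentiate a chosen lift of [a]; two lifts differ by a critical element, whose differential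
   vanishes by [cl_grad_crit]. *)
pose D a := cl (ext_gen (grad (sval (cid (pi_surj a))))).
have DE h : D (pi h) = cl (ext_gen (grad h)).
  rewrite /D; case: cid => y /= hy; apply/eqP.
  rewrite -subr_eq0 -rmorphB -ext_genN -ext_genD -gradN -gradD.
  by apply/eqP/cl_grad_crit/pi_ker; rewrite rmorphB hy subrr.
have [|||g [gD gZ gd]] := @kahler_lift _ _ eta J f D.
- move=> a b; have [x <-] := pi_surj a; have [y <-] := pi_surj b.
  by rewrite -rmorphD !DE gradD ext_genD rmorphD.
- move=> a b; have [x <-] := pi_surj a; have [y <-] := pi_surj b.
  by rewrite -rmorphM !DE !fE gradM ext_genD !ext_genZ rmorphD !rmorphM.
- by move=> c; rewrite -pi_C DE gradC ext_gen0 rmorph0.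
have g0 : g 0 = 0 by apply: (addrI (g 0)); rewrite -gD !addr0.
(* The values of [g] come from elements of degree one, so they have square zero and commute with
   scalars, as [ext_lift] demands. *)
have gP x : exists w, g x = cl (ext_gen w).
  elim/kahler_ind: x => [a||x y [v Hv] [w Hw]|x [v Hv]|a x [v Hv]].
  - by exists (grad (sval (cid (pi_surj a)))); rewrite gd.
  - by exists 0; rewrite g0 ext_gen0 rmorph0.
  - by exists (v + w); rewrite gD Hv Hw ext_genD rmorphD.
  - exists (- v); rewrite ext_genN rmorphN /= -Hv; apply/eqP.
    by rewrite eq_sym eqr_oppLR -addr_eq0 -gD subrr g0.
  - have [h <-] := pi_surj a; exists (h *: v).
    by rewrite gZ fE Hv ext_genZ rmorphM.
have [||||phi [phis phig]] := @ext_lift _ (kahler eta) J f g.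
- exact: gD.
- exact: gZ.
- move=> a m; have [h <-] := pi_surj a; have [w ->] := gP m.
  by rewrite fE /= -!rmorphM ext_scalC.
- by move=> m; have [w ->] := gP m; rewrite -rmorphM ext_gen_sq rmorph0.
by exists phi; split=> h; rewrite ?[LHS]phis ?[LHS]phig ?gd ?DE ?fE.
Qed.

(* On the critical locus of [W] the relations are [dW/du_i = 0] and
   [d (dW/du_i) = 0], that is, the two families of partial derivatives of the
   superpotential. *)
Theorem Omega_critical_locus :
  exists phi : {rmorphism Omega eta -> jacobi_ring (superpotential W)},
    [/\ bijective phi,
        forall h, phi (Omega_fun eta (pi h)) = cl (sp_even h)
      & forall i, phi (Omega_d eta (pi 'X_i)) = cl (sp_xi k i)].
Proof.
have [phi [phis phid]] := Omega_to_jacobi.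
have [psi [psis psig]] := jacobi_to_Omega.
exists phi; split=> // [|i]; last by rewrite phid gradX.
have phi_diff m : phi (ext_gen (diff m)) = cl (ext_gen m).
  rewrite ext_gen_sum rmorph_sum /= ext_gen_row rmorph_sum; apply: eq_bigr => j _.
  by rewrite ext_genZ !rmorphM [X in X * _]phis [X in _ * X]phid gradX.
(* Both composites are ring morphisms, so comparing them with the identity on scalars and on degree
   one is enough; the second is compared after composition with [cl]. *)
exists psi => [x|y].
- apply: (ext_rmorph_eq (f := psi \o phi) (g := idfun)) x => [a|m] /=.
    by have [h <-] := pi_surj a; rewrite [X in psi X]phis psis.
  elim/kahler_ind: m => [a||m m' Hm Hm'|m Hm|a m Hm].
  + by have [h <-] := pi_surj a; rewrite [X in psi X]phid psig diff_grad.
  + by rewrite ext_gen0 !rmorph0.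
  + by rewrite ext_genD !rmorphD Hm Hm'.
  + by rewrite ext_genN !rmorphN Hm.
  + have [h <-] := pi_surj a.
    by rewrite ext_genZ !rmorphM Hm [X in psi X]phis psis.
- rewrite -[y]quot_projK.
  apply: (ext_rmorph_eq (f := phi \o psi \o cl) (g := cl)) (repr y) => [h|m] /=.
    by rewrite psis phis.
  by rewrite psig phi_diff.
Qed.

End CriticalLocus.

(** * Rational powers of polynomials *)

Section IdealGenTheory.
Variables (A : pzRingType) (G : A -> Prop).

Lemma ideal_genN x : ideal_gen G x -> ideal_gen G (- x).
Proof. by rewrite -mulN1r; apply: IdealMl. Qed.

Lemma ideal_genD x y : ideal_gen G x -> ideal_gen G y -> ideal_gen G (x + y).
Proof. by move=> Gx /ideal_genN Gy; rewrite -[y]opprK; apply: IdealB. Qed.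

Lemma ideal_genMn x m : ideal_gen G x -> ideal_gen G (x *+ m).
Proof. by rewrite -mulr_natr; apply: IdealMr. Qed.

Lemma ideal_gen_sum (I : Type) (r : seq I) (P : pred I) (F : I -> A) :
  (forall i, P i -> ideal_gen G (F i)) -> ideal_gen G (\sum_(i <- r | P i) F i).
Proof. exact: (big_ind (ideal_gen G) (Ideal0 G) ideal_genD). Qed.

End IdealGenTheory.

(** * The differential equation of a rational power, modulo an ideal *)

Section PowerODE.
Variables (A : comNzRingType) (G : A -> Prop).
Local Notation I := (ideal_gen G).
Hypothesis divI : forall m x, (0 < m)%N -> I (x *+ m) -> I x.

Implicit Types f g U V D E : {poly A}.

(** Vanishing modulo the ideal and [z^M], in place of power series over the quotient ring. *)
Definition coefs_in_upto (M : nat) (f : {poly A}) := forall N, (N < M)%N -> I f`_N.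
Local Notation low := coefs_in_upto.

Lemma coefs_in_uptoB M f g : low M f -> low M g -> low M (f - g).
Proof. by move=> lf lg N NM; rewrite coefB; apply: IdealB; auto. Qed.

Lemma coefs_in_uptoMl M f g : low M g -> low M (f * g).
Proof.
move=> lg N NM; rewrite coefM; apply: ideal_gen_sum => j _.
by apply/IdealMl/lg/(leq_ltn_trans _ NM)/leq_subr.
Qed.

Lemma coefs_in_uptoMn M f m : low M f -> low M (f *+ m).
Proof. by move=> lf N NM; rewrite coefMn; apply/ideal_genMn/lf. Qed.

Lemma coefs_in_upto_deriv M f : low M.+1 f -> low M f^`().
Proof. by move=> lf N NM; rewrite coef_deriv; apply/ideal_genMn/lf. Qed.

(** A series with constant term 1 is invertible: the coefficient of [z^N] in [f * g] is that of [g]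
    plus multiples of earlier ones. *)
Lemma coefs_in_upto_cancel M f g : f`_0 = 1 -> low M (f * g) -> low M g.
Proof.
move=> f0 lfg N; elim/ltn_ind: N => N IH NM.
have := lfg N NM; rewrite coefM big_ord_recl f0 mul1r subn0 => IN.
set s := \sum_(i < N) _ in IN.
have Is : I s.
  apply: ideal_gen_sum => j _; apply/IdealMl/IH; rewrite lift0.
    by rewrite ltn_subrL (leq_ltn_trans _ (ltn_ord j)).
  by rewrite (leq_ltn_trans _ NM) ?leq_subr.
by rewrite -[g`_N](addrK s); apply: IdealB.
Qed.

(* The equation [p U D' = q U' D], whose solution with constant term 1 is
   [D = U^(q/p)]. *)
Definition pow_ode (p q : nat) (U D : {poly A}) : {poly A} :=
  (U * D^`()) *+ p - (U^`() * D) *+ q.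

Lemma pow_odeB p q U D E : pow_ode p q U (D - E) = pow_ode p q U D - pow_ode p q U E.
Proof.
rewrite /pow_ode derivB.
have ring_id (B : comPzRingType) (u u' d d' e e' : B) a b :
    (u * (d' - e')) *+ a - (u' * (d - e)) *+ b =
    (u * d') *+ a - (u' * d) *+ b - ((u * e') *+ a - (u' * e) *+ b) by ring.
exact: ring_id.
Qed.

(** In degree [N] the equation reads [p (N+1) D_(N+1)] plus multiples of earlier coefficients of
    [D]. Characteristic zero enters through [divI], which divides by [p (N+1)]. *)
Lemma pow_ode_uniq M p q U D : (0 < p)%N -> U`_0 = 1 ->
  low M (pow_ode p q U D) -> I D`_0 -> low M.+1 D.
Proof.
move=> p_gt0 U0 lode D0; elim/ltn_ind=> -[//|N] IH; rewrite ltnS => NM.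
have IHD j : (j <= N)%N -> I D`_j.
  by move=> jN; apply: IH; rewrite ltnS // (leq_trans jN) // ltnW.
have := lode N NM; rewrite coefB !coefMn coefM big_ord_recl U0 mul1r subn0.
set s := \sum_(i < N) _ => IN.
have Is : I s.
  apply: ideal_gen_sum => j _; rewrite coef_deriv lift0; apply/IdealMl/ideal_genMn.
  by apply: IHD; rewrite subnSK // leq_subr.
have It : I ((U^`() * D)`_N *+ q).
  apply: ideal_genMn; rewrite coefM; apply: ideal_gen_sum => j _.
  by apply/IdealMl/IHD/leq_subr.
apply: (divI (ltn0Sn N)); apply: (divI p_gt0); rewrite -coef_deriv.
rewrite -[_ *+ p](addrK (s *+ p)) -mulrnDl; apply: IdealB; last exact: ideal_genMn.
by rewrite -[_ *+ p](subrK ((U^`() * D)`_N *+ q)); apply: ideal_genD.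
Qed.

(** Differentiate [X = V^p - U^q]: up to the factor [V^p], which can be cancelled, the equation is a
    combination of [X] and [X']. The derivative costs one order in [z]. *)
Lemma pow_ode_of_pow_eq M p q U V : (0 < p)%N -> (0 < q)%N -> V`_0 = 1 ->
  low M.+1 (V ^+ p - U ^+ q) -> low M (pow_ode p q U V).
Proof.
move=> p_gt0 q_gt0 V0 lX; apply: (coefs_in_upto_cancel (f := V ^+ p)).
  by rewrite -horner_coef0 horner_exp horner_coef0 V0 expr1n.
set X := V ^+ p - U ^+ q in lX.
suff -> : V ^+ p * pow_ode p q U V = U * V * X^`() - (U^`() * V) * X *+ q.
  apply: coefs_in_uptoB; first exact/coefs_in_uptoMl/coefs_in_upto_deriv.
  apply/coefs_in_uptoMn/coefs_in_uptoMl => N /ltnW; exact: lX.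
rewrite /X /pow_ode derivB !deriv_exp -(prednK p_gt0) -(prednK q_gt0) /=.
rewrite !exprS.
(* Here [x] and [y] stand for [V ^+ p.-1] and [U ^+ q.-1]. *)
have ring_id (B : comPzRingType) (u u' v v' x y : B) a b :
    v * x * ((u * v') *+ a - (u' * v) *+ b) =
    u * v * ((v' * x) *+ a - (u' * y) *+ b) - (u' * v * (v * x - u * y)) *+ b by ring.
exact: ring_id.
Qed.

(** Both [V^p] and [U^q] solve [U Y' = q U' Y] to this order, so their difference, with constant
    term 0, vanishes by uniqueness for the exponents 1 and [q]. *)
Lemma pow_eq_of_pow_ode M p q U V : (0 < p)%N -> (0 < q)%N ->
  U`_0 = 1 -> V`_0 = 1 ->
  low M (pow_ode p q U V) -> low M.+1 (V ^+ p - U ^+ q).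
Proof.
move=> p_gt0 q_gt0 U0 V0 lode; apply: (@pow_ode_uniq M 1 q U) => //.
  suff -> : pow_ode 1 q U (V ^+ p - U ^+ q) = V ^+ p.-1 * pow_ode p q U V.
    exact: coefs_in_uptoMl.
  rewrite /pow_ode derivB !deriv_exp -(prednK p_gt0) -(prednK q_gt0) /=.
  rewrite !exprS.
  have ring_id (B : comPzRingType) (u u' v v' x y : B) a b :
      u * ((v' * x) *+ a - (u' * y) *+ b) - (u' * (v * x - u * y)) *+ b =
      x * ((u * v') *+ a - (u' * v) *+ b) by ring.
  exact: ring_id.
rewrite coefB -!horner_coef0 !horner_exp !horner_coef0 U0 V0 !expr1n subrr.
exact: Ideal0.
Qed.

End PowerODE.

(** * The truncated binomial series *)

Lemma gbinomS (s : rat) k :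
  gbinom s k.+1 * k.+1%:R = gbinom s k * (s - k%:R).
Proof.
rewrite /gbinom big_ord_recr /= factS natrM; field.
by rewrite nat1r !pnatr_eq0 -lt0n fact_gt0.
Qed.

(** Coefficientwise form of [f' = s (1+x)^(s-1)] for [f = (1+x)^s], just as [gbinomS] is that of
    [(1+x) f' = s f]. *)
Lemma gbinom_absorb (s : rat) k :
  gbinom s k.+1 * k.+1%:R = s * gbinom (s - 1) k.
Proof.
rewrite /gbinom big_ord_recl subr0 factS natrM.
have -> : \prod_(i < k) (s - (lift ord0 i)%:R) = \prod_(i < k) (s - 1 - i%:R).
  by apply: eq_bigr => i _; rewrite lift0 -natr1; ring.
field; by rewrite nat1r !pnatr_eq0 -lt0n fact_gt0.
Qed.

Lemma coef0_exp_low (A : nzRingType) (f : {poly A}) k N :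
  f`_0 = 0 -> (N < k)%N -> (f ^+ k)`_N = 0.
Proof.
move=> f0; elim: k N => // k IHk N; rewrite ltnS => Nk.
rewrite exprS coefM big1 // => -[[|j] jN] _ /=; first by rewrite f0 mul0r.
by rewrite IHk ?mulr0 // (leq_trans _ Nk) // ltn_subrL (leq_ltn_trans _ (jN : (j < N)%N)).
Qed.

Section BinomialSeries.
Variables (K : numFieldType) (A : comAlgType K).

Definition pow_trunc (M : nat) (U : {poly A}) (s : rat) : {poly A} :=
  \sum_(k < M.+1) (ratr (gbinom s k) : K)%:A *: (U - 1) ^+ k.

Lemma coef_pow_trunc M N (U : {poly A}) s : U`_0 = 1 -> (N <= M)%N ->
  (pow_trunc M U s)`_N = coef_pow N U s.
Proof.
move=> U0 NM; rewrite coef_sum /coef_pow.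
rewrite (big_ord_widen M.+1 (fun k => ratr (gbinom s k) *: ((U - 1) ^+ k)`_N)) //.
rewrite [RHS]big_mkcond; apply: eq_bigr => k _.
rewrite coefZ mulr_algl ltnS; case: leqP => // Nk.
by rewrite coef0_exp_low ?scaler0 // coefB U0 coef1 subrr.
Qed.

(** Consecutive terms cancel by [gbinomS], so only the last one leaves a remainder; it is divisible
    by [z^M] once [U] has constant term 1. *)
Lemma pow_trunc_ode M p q (U : {poly A}) : (0 < p)%N ->
  pow_ode p q U (pow_trunc M U (q%:R / p%:R)) =
  ((ratr (gbinom (q%:R / p%:R) M) : K)%:A * ((M * p)%:R - q%:R))%:P *
    (U^`() * (U - 1) ^+ M).
Proof.
move=> p_gt0; set s := q%:R / p%:R; set y := U - 1.
pose b k : A := (ratr (gbinom s k) : K)%:A.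
have bS k : b k.+1 *+ k.+1 *+ p = b k * (q%:R - (k * p)%:R).
  rewrite /b -mulrnA scalerMnl -mulr_natr -ratr_nat -rmorphM natrM mulrA gbinomS.
  have -> : (q%:R - (k * p)%:R : A) = (ratr (q%:R - (k * p)%:R) : K)%:A.
    by rewrite rmorphB /= !ratr_nat scalerBl !scaler_nat.
  rewrite mulr_algl scalerA -rmorphM; congr (ratr _ *: _).
  rewrite /s natrM; field; by rewrite pnatr_eq0 -lt0n.
(* The induction step: [t] is the truncation at [m], [Y] is [U - 1], [x] is [Y^m], and [c], [e] are
   the binomial coefficients of index [m] and [m+1]. *)
have ring_id (B : comPzRingType) (x t t' u' Y c e f : B) m :
    (1 + Y) * t' *+ p - u' * t *+ q = c * ((m * p)%:R - q%:R) * (u' * x) ->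
    e *+ m.+1 *+ p = c * (q%:R - (m * p)%:R) ->
    (1 + Y) * (t' + e * (u' * x *+ m.+1)) *+ p - u' * (t + e * (Y * x)) *+ q =
    e * ((m.+1 * p)%:R - q%:R) * (u' * (Y * x)).
  move=> h1 h2.
  transitivity ((1 + Y) * t' *+ p - u' * t *+ q + (e *+ m.+1 *+ p) * (u' * x) +
      e * ((m.+1 * p)%:R - q%:R) * (u' * (Y * x))); first ring.
  by rewrite h1 h2; ring.
elim: M => [|M IHM].
  rewrite /pow_trunc big_ord1 /gbinom big_ord0 fact0 divr1 rmorph1 scale1r expr0.
  by rewrite scale1r mul0n sub0r mul1r mulr1 /pow_ode derivC mulr0 mul0rn sub0r
    mulr1 polyCN mulNr -[q%:R]/(1 *+ q) polyCMn mulrnAl mul1r.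
have T_S : pow_trunc M.+1 U s = pow_trunc M U s + (b M.+1)%:P * (y * y ^+ M).
  by rewrite {1}/pow_trunc big_ord_recr mul_polyC -exprS.
rewrite T_S /pow_ode derivD deriv_mulC -exprS deriv_exp.
have -> : y^`() = U^`() by rewrite derivB derivC subr0.
rewrite exprS -{1}[U](subrK 1) -/y [y + 1]addrC.
have bS' := congr1 polyC (bS M).
rewrite !polyCMn polyCM polyCB !polyC_natr in bS'.
rewrite !polyCM !polyCB !polyC_natr in IHM *.
by apply: ring_id bS' => //; rewrite -IHM /pow_ode [1 + y]addrC subrK.
Qed.

Lemma pow_trunc_ode_low p q M (U : {poly A}) N :
  (0 < p)%N -> U`_0 = 1 -> (N < M)%N ->
  (pow_ode p q U (pow_trunc M U (q%:R / p%:R)))`_N = 0.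
Proof.
move=> p_gt0 U0 NM; rewrite pow_trunc_ode // coefCM coefM big1 ?mulr0 // => j _.
rewrite coef0_exp_low ?mulr0 ?(leq_ltn_trans (leq_subr _ _)) //.
by rewrite coefB U0 coef1 subrr.
Qed.

Lemma pow_trunc_coef0 M (U : {poly A}) s :
  U`_0 = 1 -> (pow_trunc M U s)`_0 = 1.
Proof.
move=> U0; rewrite coef_pow_trunc // /coef_pow big_ord1 expr0 coef1 /gbinom big_ord0.
by rewrite fact0 divr1 rmorph1 scale1r.
Qed.

End BinomialSeries.

(** * Ideals, generic polynomials and derivatives of coefficients *)

Lemma ideal_gen_rmorph (A B : pzRingType) (G : A -> Prop) (H : B -> Prop)
    (f : {rmorphism A -> B}) :
  (forall x, G x -> ideal_gen H (f x)) ->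
  forall x, ideal_gen G x -> ideal_gen H (f x).
Proof.
move=> GH x; elim=> {x} [x /GH //||x y _ Hx _ Hy|a x _ Hx|a x _ Hx].
- by rewrite rmorph0; apply: Ideal0.
- by rewrite rmorphB; apply: IdealB.
- by rewrite rmorphM; apply: IdealMl.
- by rewrite rmorphM; apply: IdealMr.
Qed.

Lemma ideal_gen_mpolyZ (n : nat) (K : nzRingType) (G : {mpoly K[n]} -> Prop) c x :
  ideal_gen G x -> ideal_gen G (c *: x).
Proof. by rewrite -mul_mpolyC; apply: IdealMl. Qed.

Lemma ideal_gen_mpoly_div (n : nat) (K : numFieldType) (G : {mpoly K[n]} -> Prop)
    m x : (0 < m)%N -> ideal_gen G (x *+ m) -> ideal_gen G x.
Proof.
move=> m_gt0 /(ideal_gen_mpolyZ (m%:R^-1)).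
by rewrite -scaler_nat scalerA mulVf ?scale1r // pnatr_eq0 -lt0n.
Qed.

Section Poly1.
Variables (A : nzRingType) (n : nat).
Implicit Types u : 'I_n -> A.

Lemma poly1_coef0 u : (poly1 u)`_0 = 1.
Proof.
rewrite coefD coef1 coef_sum big1 ?addr0 // => i _.
by rewrite coefZ coefXn mulr0.
Qed.

Lemma poly1_coefS u i : (poly1 u)`_(i : 'I_n).+1 = u i.
Proof.
rewrite coefD coef1 add0r coef_sum (bigD1 i) //= coefZ coefXn eqxx mulr1.
rewrite big1 ?addr0 // => j /negPf ji.
by rewrite coefZ coefXn eqSS eq_sym [_ == _]ji mulr0.
Qed.

Lemma size_poly1_leq u : (size (poly1 u) <= n.+1)%N.
Proof.
apply: (leq_trans (size_polyD _ _)); rewrite geq_max size_poly1 /=.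
apply: (leq_trans (size_sum _ _ _)); apply/bigmax_leqP => i _.
by rewrite (leq_trans (size_scale_leq _ _)) // size_polyXn ltnS.
Qed.

Lemma map_poly1 (B : nzRingType) (f : {rmorphism A -> B}) u :
  map_poly f (poly1 u) = poly1 (f \o u).
Proof.
rewrite /poly1 rmorphD rmorph1 rmorph_sum; congr (_ + _).
by apply: eq_bigr => i _; rewrite /= map_polyZ map_polyXn.
Qed.

End Poly1.

(** Applying [mderiv i] to all coefficients is a derivation of the polynomials in [z], so the power
    rule holds. *)
Lemma mderiv_coef_exp (n : nat) (K : comNzRingType) (i : 'I_n)
    (Y : {poly {mpoly K[n]}}) k N :
  (Y ^+ k)`_N^`M(i) = (Y ^+ k.-1 * map_poly (mderiv i) Y)`_N *+ k.
Proof.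
set d := map_poly (mderiv i).
have dM f g : d (f * g) = d f * g + f * d g.
  apply/polyP => m; rewrite coefD coef_map !coefM raddf_sum -big_split.
  by apply: eq_bigr => j _; rewrite !coef_map /= mderivM.
rewrite -[LHS](coef_map (mderiv i)) -/d -coefMn.
suff -> : d (Y ^+ k) = Y ^+ k.-1 * d Y *+ k by [].
elim: k => [|k IHk]; first by rewrite expr0 mulr0n /d map_polyC /= -mpolyC1 mderivC.
rewrite exprS dM IHk; case: k {IHk} => [|k]; rewrite ?mulr0n ?expr0 /=.
  by rewrite mulr0 addr0 mulr1 mul1r.
by rewrite mulrnAr mulrA -exprS [d Y * _]mulrC [RHS]mulrS.
Qed.

(** The variable of index [i] multiplies [z^(i+1)], so differentiating [U^s] gives
    [s z^(i+1) U^(s-1)], and degree [N+1] drops to [N-i]. *)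
Lemma mderiv_coef_pow (n : nat) (K : numFieldType) (i : 'I_n) N s :
  (i <= N)%N ->
  let U : {poly {mpoly K[n]}} := poly1 (fun j : 'I_n => 'X_j) in
  (coef_pow N.+1 U s)^`M(i) = ratr s *: (pow_trunc N U (s - 1))`_(N - i).
Proof.
move=> iN U.
have dU : map_poly (mderiv i) (U - 1) = 'X^(i.+1).
  apply/polyP => m; rewrite coef_map /U /poly1 addrC addKr coef_sum raddf_sum.
  rewrite (bigD1 i) //= coefZ !coefXn mulr_natr mderivMn mderivXU eqxx big1 ?addr0 // => j ji.
  by rewrite coefZ coefXn mulr_natr mderivMn mderivXU eq_sym (negPf ji) mul0rn.
rewrite /coef_pow raddf_sum big_ord_recl /= expr0 mderivZ coef1 mderiv0 scaler0 add0r.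
rewrite coef_sum scaler_sumr; apply: eq_bigr => k _.
rewrite /= mderivZ mderiv_coef_exp dU /bump leq0n add1n coefMXn ltnNge ltnS iN subSS /=.
rewrite coefZ mulr_algl scalerA -rmorphM -gbinom_absorb rmorphM /= ratr_nat.
by rewrite -scalerA scaler_nat.
Qed.

Lemma mpoly_eval_exists (n m : nat) (K : comNzRingType) (h : 'I_n -> {mpoly K[m]}) :
  exists f : {rmorphism {mpoly K[n]} -> {mpoly K[m]}},
    (forall c, f c%:MP = c%:MP) /\ (forall i, f 'X_i = h i).
Proof.
exists (mmap (@mpolyC m K) h : {rmorphism _ -> _}).
by split=> [c|i]; rewrite /= ?mmapC // mmapX mmap1U.
Qed.

(** * Elimination of the v_j *)

Section Elimination.
Variables (K : numFieldType) (n m p q : nat).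
Hypotheses (p_gt0 : (0 < p)%N) (q_gt0 : (0 < q)%N).
Local Notation P := {mpoly K[n]}.
Local Notation S := {mpoly K[n + m]}.
Variables (W : P) (T : {poly P}) (c : K).
Local Notation crit := (fun f : P => exists i, f = W^`M(i)).
Local Notation uS := (fun i : 'I_n => 'X_(lshift m i) : S).
Local Notation vS := (fun j : 'I_m => 'X_(rshift n j) : S).
Local Notation eqs := (fun f : S => exists N, f = (poly1 uS ^+ q - poly1 vS ^+ p)`_N).
Local Notation U := (poly1 (fun i : 'I_n => 'X_i : P)).
Local Notation V := (poly1 (fun j : 'I_m => T`_j.+1)).

Hypothesis T0 : T`_0 = 1.
Hypothesis T_ode : forall N, (N < n + m)%N -> (pow_ode p q U T)`_N = 0.
Hypothesis c_neq0 : c != 0.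
Hypothesis W_deriv : forall i : 'I_n, W^`M(i) = c *: T`_(n + m - i).

(** For [i < n] the degrees [n + m - i] run through exactly this range. *)
Let T_crit N : (m < N <= n + m)%N -> ideal_gen crit T`_N.
Proof.
case/andP=> mN NM.
have iP : (n + m - N < n)%N by rewrite ltn_subLR // addnC ltn_add2r.
have := W_deriv (Ordinal iP); rewrite /= subKn // => WE.
rewrite -[T`_N]scale1r -(mulVf c_neq0) -scalerA -WE.
by apply/ideal_gen_mpolyZ/IdealGen; exists (Ordinal iP).
Qed.

Let sub_T_V : coefs_in_upto crit (n + m).+1 (T - V).
Proof.
case=> [_|N NM]; first by rewrite coefB T0 poly1_coef0 subrr; apply: Ideal0.
rewrite coefB; case: (ltnP N m) => [Nm|mN].
  by rewrite (poly1_coefS _ (Ordinal Nm)) subrr; apply: Ideal0.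
rewrite [X in _ - X]nth_default ?subr0.
  by apply: T_crit; rewrite ltnS mN.
exact: leq_trans (size_poly1_leq _) _.
Qed.

(** Bounds [U V'] and [U' V], so that the equation for [V] has no coefficient in degree [n + m] or
    above. *)
Let size_derivM_leq (f g : {poly P}) a b :
  (size f <= a.+1)%N -> (size g <= b.+1)%N -> (size (f^`() * g)%R <= a + b)%N.
Proof.
move=> fa gb; apply: leq_trans (size_polyMleq _ _) _.
rewrite -subn1 leq_subLR add1n -addnS leq_add //.
by rewrite /deriv (leq_trans (size_poly _ _)) // -subn1 leq_subLR add1n.
Qed.

(* [V] satisfies the differential equation of [U^(q/p)] modulo the critical
   ideal: in degrees below [n + m] because [T] does, and in the other ones by
   the size of the polynomials. *)
Let pow_eq_crit N : ideal_gen crit (U ^+ q - V ^+ p)`_N.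
Proof.
rewrite -opprB coefN; apply: ideal_genN; move: N (ltnSn N).
move=> N; apply: (@pow_eq_of_pow_ode _ crit _ N) => //.
- exact: ideal_gen_mpoly_div.
- exact: poly1_coef0.
- exact: poly1_coef0.
move=> j _; case: (ltnP j (n + m)) => [jM|Mj].
  have -> : V = T - (T - V) by rewrite subKr.
  rewrite pow_odeB coefB T_ode // sub0r; apply: ideal_genN; move: jM.
  apply: coefs_in_uptoB; apply/coefs_in_uptoMn/coefs_in_uptoMl.
    exact: coefs_in_upto_deriv.
  by move=> l /ltnW /sub_T_V.
rewrite nth_default; first exact: Ideal0.
apply: leq_trans Mj; apply: leq_trans (size_polyD _ _) _.
rewrite size_polyN geq_max -!scaler_nat.
rewrite !(leq_trans (size_scale_leq _ _)) // ?size_derivM_leq ?size_poly1_leq //.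
by rewrite mulrC addnC size_derivM_leq ?size_poly1_leq.
Qed.

Variable incl : {rmorphism P -> S}.
Hypothesis inclC : forall a, incl a%:MP = a%:MP.
Hypothesis inclX : forall i, incl 'X_i = uS i.

Let map_incl_U : map_poly incl U = poly1 uS.
Proof.
by rewrite map_poly1; congr (_ + _); apply: eq_bigr => i _; rewrite /= inclX.
Qed.

(** Modulo the equations both polynomials solve the same differential equation with constant term 1:
    [T] by construction, the generic one because its [p]-th power is [U^q]. *)
Let incl_T : coefs_in_upto eqs (n + m).+1 (map_poly incl T - poly1 vS).
Proof.
apply: (@pow_ode_uniq _ eqs _ (n + m) p q (poly1 uS)) => //.
- exact: ideal_gen_mpoly_div.
- exact: poly1_coef0.
- rewrite pow_odeB; apply: coefs_in_uptoB.
    move=> N NM; rewrite -map_incl_U /pow_ode !deriv_map -!rmorphM -!rmorphMn -rmorphB.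
    by rewrite coef_map /= T_ode // rmorph0; apply: Ideal0.
  apply: pow_ode_of_pow_eq => //; first exact: poly1_coef0.
  by move=> N _; rewrite -(opprB (poly1 uS ^+ q)) coefN; apply/ideal_genN/IdealGen; exists N.
- by rewrite coefB coef_map /= T0 rmorph1 poly1_coef0 subrr; apply: Ideal0.
Qed.

Lemma elimination_surj f : exists h, ideal_gen eqs (incl h - f).
Proof.
elim/mpoly_ring_ind: f => [a|i|f g [h Hh] [l Hl]|f g [h Hh] [l Hl]].
- by exists a%:MP; rewrite inclC subrr; apply: Ideal0.
- rewrite -(splitK i); case: (split i) => [j|j] /=.
    by exists 'X_j; rewrite inclX subrr; apply: Ideal0.
  have jM : (j.+1 < (n + m).+1)%N by rewrite ltnS (leq_trans (ltn_ord j)) ?leq_addl.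
  by exists T`_j.+1; have := incl_T jM; rewrite coefB coef_map poly1_coefS.
- exists (h + l); rewrite rmorphD opprD addrACA; exact: ideal_genD.
- exists (h * l); rewrite rmorphM.
  have -> : incl h * incl l - f * g = (incl h - f) * incl l + f * (incl l - g).
    by rewrite mulrBl mulrBr addrA subrK.
  by apply: ideal_genD; [apply: IdealMr | apply: IdealMl].
Qed.

(** Each [dW/du_i] is a multiple of a coefficient of [T] beyond degree [m], where the generic
    polynomial in the [v_j] has none. Conversely, substituting the coefficients of [T] for the [v_j]
    retracts [incl] and maps the equations to the coefficients of [U^q - V^p], which are
    critical. *)
Lemma elimination_ker h : ideal_gen eqs (incl h) <-> ideal_gen crit h.
Proof.
split=> [Ih|]; last first.
  apply: ideal_gen_rmorph => f [i ->].
  rewrite W_deriv -mul_mpolyC rmorphM; apply: IdealMl.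
  have iM : (n + m - i < (n + m).+1)%N by rewrite ltnS leq_subr.
  have := incl_T iM; rewrite coefB coef_map (_ : (poly1 vS)`_(_ - _) = 0) ?subr0 //.
  rewrite nth_default //; apply: leq_trans (size_poly1_leq _) _.
  by rewrite ltn_subRL ltn_add2r.
have [proj [projC projX]] := mpoly_eval_exists (fun i : 'I_(n + m) =>
  match split i with inl j => 'X_j | inr l => T`_l.+1 end).
have projK f : proj (incl f) = f.
  elim/mpoly_ring_ind: f => [a|i|f g Hf Hg|f g Hf Hg].
  - by rewrite inclC projC.
  - by rewrite inclX projX (unsplitK (inl i)).
  - by rewrite !rmorphD /= Hf Hg.
  - by rewrite !rmorphM /= Hf Hg.
rewrite -[h]projK; apply: ideal_gen_rmorph Ih => f [N ->].
rewrite -coef_map rmorphB !rmorphXn /= !map_poly1.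
have -> : poly1 (proj \o uS) = U.
  congr (_ + _); apply: eq_bigr => i _.
  by rewrite /= projX (unsplitK (inl i)).
have -> : poly1 (proj \o vS) = V.
  congr (_ + _); apply: eq_bigr => i _.
  by rewrite /= projX (unsplitK (inr i)).
exact: pow_eq_crit.
Qed.

End Elimination.

(** * The scheme as the critical locus of its potential *)

Theorem mainTheorem1 (R : realType) (p q r : nat)
    (p_gt0 : (0 < p)%N) (q_gt0 : (0 < q)%N) (pq_coprime : coprime p q)
    (r_gt0 : (1 <= r)%N) :
  exists phi : {rmorphism Omega (Mpqr_const R p q r) ->
                          jacobi_ring (Wsuper R p q r)},
    [/\ bijective phi,
        forall c : R[i],
          phi (Omega_fun (Mpqr_const R p q r) (Mpqr_const R p q r c)) =
          jacobi_class (Wsuper R p q r) (sp_even c%:MP),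
        forall i : 'I_(p * r),
          phi (Omega_fun (Mpqr_const R p q r) (Mpqr_class (Mpqr_u R q i))) =
          jacobi_class (Wsuper R p q r) (sp_even 'X_i)
      & forall i : 'I_(p * r),
          phi (Omega_d (Mpqr_const R p q r) (Mpqr_class (Mpqr_u R q i))) =
          jacobi_class (Wsuper R p q r) (sp_xi R[i] i)].
Proof.
have [incl [inclC inclX]] := mpoly_eval_exists (@Mpqr_u R p q r).
pose U : {poly {mpoly R[i][p * r]}} := poly1 (fun i => 'X_i).
have U0 : U`_0 = 1 by exact: poly1_coef0.
(* The top degree at which a derivative of [W] occurs; the truncation at [M] is correct up to and
   including [z^M]. *)
pose M := (p * r + q * r)%N.
have [T T_def] : exists T, T = pow_trunc M U (q%:R / p%:R) by eexists.
have T0 : T`_0 = 1 by rewrite T_def; apply: pow_trunc_coef0.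
have T_ode N : (N < M)%N -> (pow_ode p q U T)`_N = 0.
  by rewrite T_def; apply: pow_trunc_ode_low.
have c_neq0 : ratr ((q + p)%:R / p%:R) != 0 :> R[i].
  rewrite fmorph_eq0 mulf_neq0 ?invr_eq0 ?pnatr_eq0 -?lt0n //.
  by rewrite addn_gt0 q_gt0.
have W_deriv (i : 'I_(p * r)) :
    (potential R p q r)^`M(i) = ratr ((q + p)%:R / p%:R) *: T`_(M - i).
  have iM : (i <= M)%N by rewrite ltnW // (leq_trans (ltn_ord i)) ?leq_addr.
  rewrite /potential mulnDl (@mderiv_coef_pow (p * r) R[i] i M _ iM) T_def.
  suff -> : (q + p)%:R / p%:R - 1 = q%:R / p%:R :> rat by [].
  by rewrite natrD mulrDl divff ?addrK // pnatr_eq0 -lt0n.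
(* Elimination presents the coordinate ring by the [u_i] alone, with the critical ideal as
   kernel. *)
pose pi : {rmorphism {mpoly R[i][p * r]} -> Mpqr R p q r} :=
  quot_proj (@Mpqr_eqs R p q r) \o incl.
have pi_C c : pi c%:MP = Mpqr_const R p q r c by rewrite /pi /= inclC.
have pi_X i : pi 'X_i = Mpqr_class (Mpqr_u R q i) by rewrite /pi /= inclX.
have pi_surj a : exists h, pi h = a.
  have [h Hh] := elimination_surj p_gt0 q_gt0 T0 T_ode inclC inclX (repr a).
  by exists h; rewrite -[a]quot_projK; apply/quot_projP.
have pi_ker h :
    pi h = 0 <-> ideal_gen (fun f => exists i, f = (potential R p q r)^`M(i)) h.
  apply: iff_trans (quot_proj_eq0 _ _) _.
  exact: (elimination_ker p_gt0 q_gt0 T0 T_ode c_neq0 W_deriv inclC inclX).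
have [phi [phi_bij phis phid]] := Omega_critical_locus pi_C pi_surj pi_ker.
exists phi; split=> // [c|i|i]; first by rewrite -pi_C phis.
  by rewrite -pi_X phis.
by rewrite -pi_X phid.
Qed.
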